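(* Let $S$ be a Hermitian positive definite $n\times n$ matrix, let $m\ge 1$ be an integer, and for pairs $(Z,\delta)$ of $n\times n$ matrices let $$h_m(Z, \delta) = \begin{bmatrix} Z \sum_{k=0}^m b_k\delta^k \\ \delta - \left(Z \sum_{k=0}^m b_k\delta^k\right)^*S\left(Z \sum_{k=1}^m b_k\delta^k\right) - \left(Z \sum_{k=1}^m b_k\delta^k\right)^*SZ \end{bmatrix}.$$ Let $Z^*SZ=I$. Then the Fréchet derivative of $h_m$ at $(Z,0)$ in direction $(E,F)$ is $$L_{h_m}(Z,0;E,F) = \begin{bmatrix} E+\frac{1}{2}ZF \\ \frac{1}{2}(F-F^* ) \end{bmatrix},$$ and for every integer $p\ge 1$ its $p$-fold composition in the direction argument is $$L_{h_m}^p(Z,0;E,F) = \begin{bmatrix} E+\frac{1}{2}ZF + (p-1)\frac{1}{4}Z(F-F^* ) \\ \frac{1}{2}(F-F^* ) \end{bmatrix}.$$ In particular, $L_{h_m}^2(Z,0;E,F)=L_{h_m}(Z,0;E,F)$ whenever $F$ is Hermitian, and hence the iteration $(Z_{i+1},\delta_{i+1})=h_m(Z_i,\delta_i)$ is stable in a neighborhood of the fixed point $(Z,0)$ if only Hermitian perturbations $F$ of $\delta$ are allowed.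
   Context: Matrices are complex and $^*$ denotes the conjugate transpose. The coefficients are $b_0 = 1$, $b_k = \frac{2k-1}{2k}b_{k-1}$ for $k=1,\dots,m$. The Fréchet derivative $L_f(X;E)$ of a function $f$ at $X$ in direction $E$ is the mapping, linear in $E$ (over the real numbers), satisfying $L_f(X;E)=f(X+E)-f(X)+o(\|E\|)$ for all $E$. $L_f^p(X;E)$ denotes $p$-fold composition in the direction argument, e.g. $L_f^2(X;E)=L_f(X;L_f(X;E))$. An iteration $X_{i+1}=f(X_i)$ is called stable in a neighborhood of a fixed point $X=f(X)$ if $L_f(X;E)$ exists at $X$ and there is a constant $c$ such that $\|L_f^p(X;E)\|\le c\|E\|$ for all (allowed) directions $E\neq 0$ and every integer $p>0$. *)

(* Defs.v *)
From HB Require Import structures.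
From mathcomp Require Import all_boot all_order all_algebra.
From mathcomp Require Import sesquilinear spectral.
From mathcomp Require Import complex.
From mathcomp Require Import all_classical all_reals.
From mathcomp Require Import topology normedtype landau.

Set Implicit Arguments.
Unset Strict Implicit.
Unset Printing Implicit Defensive.

Import Order.TTheory GRing.Theory Num.Theory.
Import numFieldNormedType.Exports.

Local Open Scope classical_set_scope.
Local Open Scope ring_scope.
Local Open Scope complex_scope.
Local Open Scope sesquilinear_scope.

Section Frechet.
Context {R : realType} {V W : normedModType R[i]}.
Implicit Types (f L : V -> W) (X E : V).

(* Linearity over R only: conjugate transposition is not C-linear, so the
   C-linear differential 'd of the library does not apply. *)
Definition real_linear L :=
  forall (a : R) E E', L (a%:C *: E + E') = a%:C *: L E + L E'.

Definition is_frechet f X L :=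
  real_linear L /\ (fun E => f (X + E) - f X - L E) =o_ (0 : V) id.

Definition frechet_differentiable f X := exists L, is_frechet f X L.

(* The value L_f(X; E) is [frechet f X E]; it is only meaningful when
   [frechet_differentiable f X] holds. *)
Definition frechet f X : V -> W := get (is_frechet f X).

End Frechet.

(* Norms on V take values in R[i], whence the cast c%:C.
   [allowed] is the set of admissible directions. *)
Definition stable_at (R : realType) (V : normedModType R[i])
    (f : V -> V) (X : V) (allowed : set V) :=
  [/\ f X = X,
      frechet_differentiable f X &
      exists c : R, forall E, allowed E -> E != 0 ->
        forall p, (0 < p)%N -> `|iter p (frechet f X) E| <= c%:C * `|E| ].

Definition hermposdefmx (C : numClosedFieldType) n (S : 'M[C]_n) :=
  S \is hermsymmx /\
  forall v : 'cV[C]_n, v != 0 -> 0 < (v ^t* *m S *m v) 0 0.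

Fixpoint bcoef (K : fieldType) (k : nat) : K :=
  if k is k'.+1 then (2 * k - 1)%N%:R / (2 * k)%N%:R * bcoef K k' else 1.

Definition hmap (C : numClosedFieldType) n (S : 'M[C]_n) (m : nat)
    (Zd : 'M[C]_n * 'M[C]_n) : 'M[C]_n * 'M[C]_n :=
  let: (Z, d) := Zd in
  let A := Z *m \sum_(0 <= k < m.+1) bcoef C k *: d ^+ k in
  let B := Z *m \sum_(1 <= k < m.+1) bcoef C k *: d ^+ k in
  (A, d - A ^t* *m S *m B - B ^t* *m S *m Z).

(* Main.v *)
Require Import Defs.
From HB Require Import structures.
From mathcomp Require Import all_boot all_order all_algebra.
From mathcomp Require Import sesquilinear spectral.
From mathcomp Require Import complex.
From mathcomp Require Import all_classical all_reals.
From mathcomp Require Import ring.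
From mathcomp Require Import interval_inference topology normedtype landau.

Set Implicit Arguments.
Unset Strict Implicit.
Unset Printing Implicit Defensive.

Import Order.TTheory GRing.Theory Num.Theory.
Import numFieldNormedType.Exports.

Local Open Scope classical_set_scope.
Local Open Scope ring_scope.
Local Open Scope complex_scope.
Local Open Scope sesquilinear_scope.

(** Derivatives that are real-linear and bounded obey the usual differentiation
    rules, including the product rule for matrices.  At delta = 0 the power
    delta^k has derivative F for k = 1 and 0 otherwise, so each sum of the
    b_k delta^k contributes b_1 F = F / 2, and Z^* S Z = I collapses the second
    component to F - F / 2 - F^* / 2.  This derivative is a map whose second
    component G = (F - F^* ) / 2 is skew-Hermitian, hence reproduced by every
    further application, which adds Z G / 2 to the first component; for
    Hermitian F one has G = 0 and the iterates are constant. *)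

(** * Estimates for the entrywise maximum norm *)

Section MatrixNorm.
Context {C : numClosedFieldType}.

Lemma mx_norm_ge m n (A : 'M[C]_(m, n)) i j : `|A i j| <= `|A|.
Proof.
rewrite [leRHS]/Num.Def.normr /= mx_normE -[leLHS]nngE num_le.
by apply/bigmax_geP; right; exists (i, j).
Qed.

Lemma mx_norm_le m n (A : 'M[C]_(m, n)) c :
  0 <= c -> (forall i j, `|A i j| <= c) -> `|A| <= c.
Proof.
move=> c0 Ac; rewrite [leLHS]/Num.Def.normr /=.
(* A nonzero norm is attained at some entry; norm zero, which includes empty matrices, is covered by
   [0 <= c]. *)
have [->//|] := eqVneq (mx_norm A) 0.
by move=> /mx_norm_neq0 [ij ->].
Qed.

(** The maximum norm is not submultiplicative: an entry of the product is a sum of [n] terms, whence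
    the factor [n]. *)
Lemma mx_norm_mulmx_le m n p (A : 'M[C]_(m, n)) (B : 'M[C]_(n, p)) :
  `|A *m B| <= n%:R * `|A| * `|B|.
Proof.
apply: mx_norm_le => [|i j]; first by rewrite !mulr_ge0.
rewrite mxE (le_trans (ler_norm_sum _ _ _)) // -mulrA mulr_natl.
rewrite -[X in _ *+ X]card_ord -sumr_const ler_sum // => k _.
by rewrite normrM ler_pM ?mx_norm_ge.
Qed.

Lemma mx_norm_trmxC m n (A : 'M[C]_(m, n)) : `|A ^t*| = `|A|.
Proof.
(* Conjugate transposition is an involution, so one inequality, used for [A] and for its conjugate
   transpose, gives both. *)
suff le q r (B : 'M[C]_(q, r)) : `|B ^t*| <= `|B|.
  by apply/eqP; rewrite eq_le le -{1}[A]trmxCK le.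
by apply: mx_norm_le => // i j; rewrite !mxE norm_conjC mx_norm_ge.
Qed.

End MatrixNorm.

(** * Uniqueness and rules of calculus for real-linear derivatives *)

Section FrechetCalculus.
Context {R : realType}.
Implicit Types V W : normedModType R[i].

Lemma is_frechetP V W (f : V -> W) X L : real_linear L ->
  is_frechet f X L <-> forall e : R[i], 0 < e ->
    \forall E \near (0 : V), `|f (X + E) - f X - L E| <= e * `|E|.
Proof.
move=> linL; split=> [[_ /eqoP fL] //|fL]; split=> //.
exact/eqoP.
Qed.

Lemma real_linear0 V W (L : V -> W) : real_linear L -> L 0 = 0.
Proof.
move=> /(_ 1 0 0); rewrite !rmorph1 !scale1r addr0 => /eqP.
by rewrite -subr_eq0 opprD addNKr oppr_eq0 => /eqP.
Qed.

Lemma real_linearZ V W (L : V -> W) (a : R) E :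
  real_linear L -> L (a%:C *: E) = a%:C *: L E.
Proof. by move=> linL; rewrite -[_ *: E]addr0 linL real_linear0 ?addr0. Qed.

(** The difference of two derivatives is o(|E|) and homogeneous under positive real scaling, so
    shrinking [E] along its ray forces it to vanish. *)
Lemma is_frechet_unique V W (f : V -> W) X L1 L2 :
  is_frechet f X L1 -> is_frechet f X L2 -> L1 = L2.
Proof.
move=> fL1 fL2; have [lin1 lin2] := (proj1 fL1, proj1 fL2).
apply/funext => E; apply/eqP; rewrite -subr_eq0 -normr_le0.
apply/ler_addgt0Pr => e e0; rewrite add0r.
(* At [t *: E] the two errors add up to [t * e * |E| / (|E| + 1)], at most [t * e]; the added 1
   keeps the divisor positive when [E] is 0. *)
pose e' := e / 2 / (`|E| + 1).
have e'0 : 0 < e' by rewrite !divr_gt0 // ltr_wpDl.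
move/is_frechetP: fL1 => /(_ lin1 _ e'0) near1.
move/is_frechetP: fL2 => /(_ lin2 _ e'0) near2.
(* Only real multiples of E may be compared, so evaluate at (r / 2) *: E. *)
have := near0Z E (filterI near1 near2).
move=> /(_ _) /nbhs_ballP[r /= r0 rP].
(* The radius lives in [R[i]], but a positive complex number is real, so [r / 2] is an admissible
   scalar for real linearity. *)
have r2r : r / 2 \is Num.real by rewrite ger0_real // divr_ge0 // ltW.
have r20 : 0 < r / 2 by rewrite divr_gt0.
have /rP : ball 0 r (r / 2).
  by rewrite -ball_normE /= sub0r normrN gtr0_norm // gtr_pMr // invf_lt1 // ltr1n.
rewrite /= -(RRe_real r2r) (@real_linearZ _ _ L1) ?(@real_linearZ _ _ L2) //.
set t := _%:C; have t0 : 0 < t by rewrite /t RRe_real.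
move=> [le1 le2].
have : `|t *: (L1 E - L2 E)| <= t * e.
  rewrite scalerBr; set d := f _ - f _ in le1 le2.
  rewrite (le_trans (ler_distD d _ _)) // distrC.
  rewrite (le_trans (lerD le1 le2)) // -mulrDl /e' -mulrDl -splitr.
  rewrite normrZ gtr0_norm // mulrCA ler_pM2l // -mulrA ler_piMr ?(ltW e0) //.
  by rewrite mulrC ler_pdivrMr ?ltr_wpDl // mul1r lerDl.
by rewrite normrZ gtr0_norm // ler_pM2l.
Qed.


(* Real linearity alone does not make L bounded; the product rule below needs
   both factors to have bounded derivatives. *)
Definition bounded_frechet V W (f : V -> W) X L :=
  is_frechet f X L /\
  exists2 C : R[i], 0 <= C & forall E, `|L E| <= C * `|E|.

Lemma bounded_frechetP V W (f : V -> W) X L :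
    real_linear L ->
    (exists2 C : R[i], 0 <= C & forall E, `|L E| <= C * `|E|) ->
    (forall e : R[i], 0 < e ->
      \forall E \near (0 : V), `|f (X + E) - f X - L E| <= e * `|E|) ->
  bounded_frechet f X L.
Proof. by move=> linL bL fL; split=> //; apply/is_frechetP. Qed.

Lemma bounded_frechet_cst V W (c : W) (X : V) :
  bounded_frechet (fun=> c) X (fun=> 0).
Proof.
apply: bounded_frechetP.
- by move=> a E E'; rewrite scaler0 addr0.
- by exists 0 => // E; rewrite normr0 mul0r.
- by move=> e e0; apply: nearW => E; rewrite subrr subr0 normr0 mulr_ge0 // ltW.
Qed.

Lemma bounded_frechet_linear V W (T : V -> W) X C : real_linear T ->
  0 <= C -> (forall E, `|T E| <= C * `|E|) -> bounded_frechet T X T.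
Proof.
move=> linT C0 TC; apply: bounded_frechetP => //; first by exists C.
move=> e e0; apply: nearW => E; have := linT 1 X E.
rewrite rmorph1 !scale1r => ->.
by rewrite [T X + _]addrC addrK subrr normr0 mulr_ge0 // ltW.
Qed.

Lemma bounded_frechet_fst V W (X : V * W) : bounded_frechet fst X fst.
Proof.
apply: (@bounded_frechet_linear _ _ _ _ 1) => // -[E F].
by rewrite mul1r prod_normE comparable_le_max ?lexx // real_comparable.
Qed.

Lemma bounded_frechet_snd V W (X : V * W) : bounded_frechet snd X snd.
Proof.
apply: (@bounded_frechet_linear _ _ _ _ 1) => // -[E F].
by rewrite mul1r prod_normE comparable_le_max ?lexx ?orbT // real_comparable.
Qed.

Lemma bounded_frechetD V W (f g : V -> W) X Lf Lg :
  bounded_frechet f X Lf -> bounded_frechet g X Lg ->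
  bounded_frechet (fun x => f x + g x) X (fun E => Lf E + Lg E).
Proof.
move=> [fX [Cf Cf0 Lfle]] [gX [Cg Cg0 Lgle]].
have [linf ling] := (proj1 fX, proj1 gX).
apply: bounded_frechetP.
- by move=> a E E'; rewrite linf ling scalerDr addrACA.
- exists (Cf + Cg) => [|E]; first exact: addr_ge0.
  by rewrite mulrDl (le_trans (ler_normD _ _)) // lerD.
move=> e e0; have e20 : 0 < e / 2 by rewrite divr_gt0.
move/is_frechetP: fX => /(_ linf _ e20) fX.
move/is_frechetP: gX => /(_ ling _ e20) gX.
near=> E.
have -> : f (X + E) + g (X + E) - (f X + g X) - (Lf E + Lg E) =
    (f (X + E) - f X - Lf E) + (g (X + E) - g X - Lg E).
  by rewrite [RHS]addrACA [X in _ = X + _]addrACA -!opprD.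
rewrite [e]splitr mulrDl (le_trans (ler_normD _ _)) // lerD //.
- by near: E.
- by near: E.
Unshelve. all: by end_near. Qed.

(** The remainder of [T \o f] is [T] applied to that of [f]. Asking only real linearity of [T] lets
    this cover conjugate transposition along with negation and scaling. *)
Lemma bounded_frechet_comp_linear V W W' (T : W -> W') C (f : V -> W) X L :
    real_linear T -> 0 <= C -> (forall E, `|T E| <= C * `|E|) ->
  bounded_frechet f X L -> bounded_frechet (T \o f) X (T \o L).
Proof.
move=> linT C0 TC [fX [D D0 LD]]; have linL := proj1 fX.
have TB u v : T (u - v) = T u - T v.
  by have := linT (-1) v u; rewrite rmorphN rmorph1 !scaleN1r !(addrC (- _)).
apply: bounded_frechetP.
- by move=> a E E'; rewrite /= linL linT.
- exists (C * D) => [|E /=]; first exact: mulr_ge0.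
  by rewrite -mulrA (le_trans (TC _)) // ler_wpM2l.
(* [C] may be 0, so the tolerance is divided by [C + 1]. *)
move=> e e0; have C1 : 0 < C + 1 by rewrite ltr_wpDl.
have eC : 0 < e / (C + 1) by rewrite divr_gt0.
move/is_frechetP: fX => /(_ linL _ eC); apply: filterS => E le.
rewrite /= -!TB (le_trans (TC _)) // (le_trans (ler_wpM2l C0 le)) //.
rewrite mulrA ler_wpM2r // mulrCA ler_piMr ?(ltW e0) //.
by rewrite ler_pdivrMr // mul1r lerDl.
Qed.

Lemma bounded_frechetN V W (f : V -> W) X L : bounded_frechet f X L ->
  bounded_frechet (fun x => - f x) X (fun E => - L E).
Proof.
apply: (@bounded_frechet_comp_linear _ _ _ (fun w => - w) 1) => // [|E].
- by move=> a E E'; rewrite opprD scalerN.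
- by rewrite normrN mul1r.
Qed.

Lemma bounded_frechetZ V W (c : R[i]) (f : V -> W) X L :
  bounded_frechet f X L ->
  bounded_frechet (fun x => c *: f x) X (fun E => c *: L E).
Proof.
apply: (@bounded_frechet_comp_linear _ _ _ (fun w => c *: w) `|c|) => // [|E].
- by move=> a E E'; rewrite scalerDr !scalerA mulrC.
- by rewrite normrZ.
Qed.

Lemma bounded_frechet_trmxC V m n (f : V -> 'M[R[i]]_(m, n)) X L :
  bounded_frechet f X L ->
  bounded_frechet (fun x => (f x) ^t* ) X (fun E => (L E) ^t* ).
Proof.
apply: (@bounded_frechet_comp_linear _ _ _ (fun A : 'M[R[i]]_(m, n) => A ^t* ) 1)
    => // [|A].
- move=> a A B; apply/matrixP => i j; rewrite !mxE rmorphD rmorphM /=.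
  by rewrite conj_Creal // complex_real.
- by rewrite mx_norm_trmxC mul1r.
Qed.

(** A product space carries the maximum norm, so bounds on both components suffice. *)
Lemma bounded_frechet_pair V W W' (f : V -> W) (g : V -> W') X Lf Lg :
  bounded_frechet f X Lf -> bounded_frechet g X Lg ->
  bounded_frechet (fun x => (f x, g x)) X (fun E => (Lf E, Lg E)).
Proof.
have le_pair (c : R[i]) (u : W) (v : W') :
    `|u| <= c -> `|v| <= c -> `|(u, v)| <= c.
  move=> uc vc; rewrite prod_normE comparable_ge_max ?real_comparable //=.
  by rewrite uc.
move=> [fX [Cf Cf0 Lfle]] [gX [Cg Cg0 Lgle]].
have [linf ling] := (proj1 fX, proj1 gX).
apply: bounded_frechetP.
- by move=> a E E'; rewrite linf ling.
- exists (Cf + Cg) => [|E]; first exact: addr_ge0.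
  apply: le_pair; rewrite mulrDl.
  + by rewrite (le_trans (Lfle _)) // lerDl mulr_ge0.
  + by rewrite (le_trans (Lgle _)) // lerDr mulr_ge0.
move=> e e0.
move/is_frechetP: fX => /(_ linf _ e0) fX.
move/is_frechetP: gX => /(_ ling _ e0) gX.
by near=> E; apply: le_pair; near: E.
Unshelve. all: by end_near. Qed.

Lemma bounded_frechet_sum V W I (r : seq I) (f L : I -> V -> W) X :
  (forall i, bounded_frechet (f i) X (L i)) ->
  bounded_frechet (fun x => \sum_(i <- r) f i x) X
    (fun E => \sum_(i <- r) L i E).
Proof.
move=> fL; elim: r => [|i r IHr].
  under eq_fun do rewrite big_nil; under [X in bounded_frechet _ _ X]eq_fun do
    rewrite big_nil.
  exact: bounded_frechet_cst.
under eq_fun do rewrite big_cons; under [X in bounded_frechet _ _ X]eq_fun do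
  rewrite big_cons.
exact: bounded_frechetD.
Qed.

Lemma near_norm_le V (e : R[i]) :
  0 < e -> \forall E \near (0 : V), `|E| <= e.
Proof.
move=> e0; apply/nbhs_ballP; exists e => //= E.
by rewrite -ball_normE /= sub0r normrN => /ltW.
Qed.

(** The remainder splits into (remainder of f) g(X+E), f(X) (remainder of g) and Lf(E) (g(X+E) -
    g(X)). The first two are small by differentiability, the third because it is quadratic in
    |E|. *)
Lemma bounded_frechetM V m n p (f : V -> 'M[R[i]]_(m, n))
    (g : V -> 'M[R[i]]_(n, p)) X Lf Lg :
  bounded_frechet f X Lf -> bounded_frechet g X Lg ->
  bounded_frechet (fun x => f x *m g x) X
    (fun E => Lf E *m g X + f X *m Lg E).
Proof.
move=> [fX [Cf Cf0 Lfle]] [gX [Cg Cg0 Lgle]].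
have [linf ling] := (proj1 fX, proj1 gX).
apply: bounded_frechetP.
- move=> a E E'; rewrite linf ling mulmxDl mulmxDr -!scalemxAl -scalemxAr.
  by rewrite scalerDr addrACA.
- exists (n%:R * Cf * `|g X| + n%:R * `|f X| * Cg) => [|E].
    by rewrite addr_ge0 // !mulr_ge0.
  rewrite (le_trans (ler_normD _ _)) // mulrDl lerD //.
    rewrite (le_trans (mx_norm_mulmx_le _ _)) // [leRHS]mulrAC ler_wpM2r //.
    by rewrite -mulrA ler_wpM2l.
  by rewrite (le_trans (mx_norm_mulmx_le _ _)) // -[leRHS]mulrA ler_wpM2l // mulr_ge0.
move=> e e0.
(* The first three summands are the constants bounding the three pieces of the remainder; the final
   1 makes [K] positive. *)
pose K := n%:R * (`|g X| + (Cg + 1)) + n%:R * `|f X| + n%:R * Cf * (Cg + 1) + 1.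
have Cg1 : 0 <= Cg + 1 by rewrite addr_ge0.
have K0 : 0 < K by rewrite ltr_wpDl // !addr_ge0 ?mulr_ge0 ?addr_ge0.
have d0 : 0 < e / K by rewrite divr_gt0.
have near1 := near_norm_le V (@ltr01 R[i]).
have neard := near_norm_le V d0.
move/is_frechetP: fX => /(_ linf _ d0) fd.
(* Tolerance 1 bounds the increment of [g] by [(Cg + 1) * |E|], however large [e / K] is. *)
move/is_frechetP: (gX) => /(_ ling _ ltr01) g1.
move/is_frechetP: gX => /(_ ling _ d0) gd.
near=> E.
have E1 : `|E| <= 1 by near: E.
have Ed : `|E| <= e / K by near: E.
have rf : `|f (X + E) - f X - Lf E| <= e / K * `|E| by near: E.
have rg : `|g (X + E) - g X - Lg E| <= e / K * `|E| by near: E.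
have rg1 : `|g (X + E) - g X - Lg E| <= 1 * `|E| by near: E.
set f' := f (X + E) in rf *; set g' := g (X + E) in rg rg1 *.
have -> : f' *m g' - f X *m g X - (Lf E *m g X + f X *m Lg E) =
    (f' - f X - Lf E) *m g' + f X *m (g' - g X - Lg E) + Lf E *m (g' - g X).
  rewrite !mulmxBl !mulmxBr.
  move: (f' *m g') (f X *m g') (f X *m g X) (Lf E *m g') (Lf E *m g X)
    (f X *m Lg E) => a b c d u v.
  apply/matrixP => i j; rewrite !mxE; ring.
have dg : `|g' - g X| <= (Cg + 1) * `|E|.
  rewrite -[g' - g X](subrK (Lg E)) (le_trans (ler_normD _ _)) // addrC mulrDl.
  by rewrite lerD.
have g'le : `|g'| <= `|g X| + (Cg + 1).
  rewrite -[g'](subrK (g X)) (le_trans (ler_normD _ _)) // addrC lerD2l.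
  by rewrite (le_trans dg) // ler_piMr.
have qE0 : 0 <= e / K * `|E| by rewrite mulr_ge0 // ltW.
apply: (@le_trans _ _ ((K - 1) * (e / K * `|E|))); last first.
  rewrite mulrA ler_wpM2r // mulrCA ler_piMr ?(ltW e0) //.
  by rewrite ler_pdivrMr // mul1r gerBl.
rewrite /K addrK 2!mulrDl.
rewrite (le_trans (ler_normD _ _)) // lerD //.
  rewrite (le_trans (ler_normD _ _)) // lerD //.
    rewrite (le_trans (mx_norm_mulmx_le _ _)) // mulrAC.
    by rewrite ler_pM ?mulr_ge0 // ler_wpM2l.
  by rewrite (le_trans (mx_norm_mulmx_le _ _)) // ler_wpM2l ?mulr_ge0.
rewrite (le_trans (mx_norm_mulmx_le _ _)) //.
apply: (@le_trans _ _ (n%:R * (Cf * `|E|) * ((Cg + 1) * `|E|))).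
  by rewrite ler_pM ?mulr_ge0 // ler_wpM2l.
have -> : n%:R * (Cf * `|E|) * ((Cg + 1) * `|E|) =
    n%:R * Cf * (Cg + 1) * (`|E| * `|E|) by ring.
by rewrite ler_wpM2l ?mulr_ge0 // ler_wpM2r.
Unshelve. all: by end_near. Qed.

Lemma bounded_frechet_eq V W (f : V -> W) X L L' :
  L =1 L' -> bounded_frechet f X L -> bounded_frechet f X L'.
Proof. by move=> /funext ->. Qed.

(** [frechet] chooses some derivative; uniqueness identifies the choice with [L]. *)
Lemma bounded_frechet_frechet V W (f : V -> W) X L : bounded_frechet f X L ->
  frechet_differentiable f X /\ frechet f X = L.
Proof.
move=> [fXL _]; split; first by exists L.
by apply: (is_frechet_unique _ fXL); apply: (getI fXL).
Qed.

End FrechetCalculus.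

Lemma hermsymmx_trmxC (C : numClosedFieldType) n (F : 'M[C]_n) :
  F \is hermsymmx -> F ^t* = F.
Proof. by rewrite is_hermitianmxE expr0 scale1r => /eqP <-. Qed.

Lemma trmxC0 (C : numClosedFieldType) m n : (0 : 'M[C]_(m, n)) ^t* = 0.
Proof. by rewrite trmx0 map_mx0. Qed.

Lemma trmxC_half (C : numClosedFieldType) m n (A : 'M[C]_(m, n)) :
  (2^-1 *: A) ^t* = 2^-1 *: A ^t*.
Proof.
by apply/matrixP => i j; rewrite !mxE rmorphM rmorphV ?unitfE //= conjC_nat.
Qed.

Lemma trmxC_mul (C : numClosedFieldType) m n p (A : 'M[C]_(m, n))
  (B : 'M[C]_(n, p)) : (A *m B) ^t* = B ^t* *m A ^t*.
Proof. by rewrite trmx_mul map_mxM. Qed.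

(** * The truncated binomial sums at delta = 0 *)

Section BinomialSum.
Context {R : realType} {n : nat}.
Notation M := 'M[R[i]]_n.

Lemma bounded_frechet_expr_snd (Z : M) k :
  bounded_frechet (fun x : M * M => x.2 ^+ k) (Z, 0)
    (fun E => if k == 1%N then E.2 else 0).
Proof.
(* Both factors of [x.2 * x.2 ^+ l.+1] vanish at delta = 0, so the product rule gives 0 whatever [L]
   is; mere existence of [L] suffices below. *)
have higher l L : bounded_frechet (fun x : M * M => x.2 ^+ l.+1) (Z, 0) L ->
    bounded_frechet (fun x : M * M => x.2 ^+ l.+2) (Z, 0) (fun=> 0).
  move=> Lk; have := bounded_frechetM (bounded_frechet_snd (Z, 0)) Lk.
  under eq_fun do rewrite mulmxE -exprS.
  by apply: bounded_frechet_eq => E; rewrite exprS mul0r mulmx0 mul0mx addr0.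
case: k => [|[|k]] /=.
- by under eq_fun do rewrite expr0; exact: bounded_frechet_cst.
- exact: bounded_frechet_snd.
suff [L] : exists L, bounded_frechet (fun x : M * M => x.2 ^+ k.+1) (Z, 0) L.
  exact: higher.
elim: k => [|k [L IHk]]; first by exists snd; exact: bounded_frechet_snd.
by exists (fun=> 0); exact: higher IHk.
Qed.

Lemma bsum_expr0 m j : \sum_(j <= k < m.+1) bcoef R[i] k *: (0 : M) ^+ k =
  if j == 0%N then 1%:M else 0.
Proof.
have high l : (0 < l)%N ->
    \sum_(l <= k < m.+1) bcoef R[i] k *: (0 : M) ^+ k = 0.
  move=> l0; rewrite big_nat_cond big1 // => -[|k] /andP[/andP[lk _] _].
    by move: l0; rewrite ltnNge lk.
  by rewrite exprS mul0r scaler0.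
case: j => [|j]; last by rewrite high.
by rewrite big_ltn // high // addr0 scale1r.
Qed.

(** The hypotheses put the index 1 in the range, and only that summand has a nonzero derivative;
    sums from 0 and from 1 thus share it. *)
Lemma bounded_frechet_bsum (Z : M) m j : (0 < m)%N -> (j <= 1)%N ->
  bounded_frechet
    (fun x : M * M => \sum_(j <= k < m.+1) bcoef R[i] k *: x.2 ^+ k) (Z, 0)
    (fun E => 2^-1 *: E.2).
Proof.
move=> m0 j1.
have := bounded_frechet_sum (index_iota j m.+1)
  (fun k => bounded_frechetZ (bcoef R[i] k) (bounded_frechet_expr_snd Z k)).
apply: bounded_frechet_eq => E.
rewrite (bigD1_seq 1%N) ?iota_uniq ?mem_index_iota ?j1 ?ltnS //= big1 => [|k].
  by rewrite addr0 mul1r mulr1.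
by case: eqP; rewrite ?scaler0.
Qed.

End BinomialSum.

Lemma bounded_frechet_hmap (R : realType) (n m : nat) (S Z : 'M[R[i]]_n) :
    (0 < m)%N -> Z ^t* *m S *m Z = 1%:M ->
  bounded_frechet (hmap S m) (Z, 0)
    (fun EF => (EF.1 + 2^-1 *: (Z *m EF.2), 2^-1 *: (EF.2 - EF.2 ^t* ))).
Proof.
move=> m0 Z_orth.
pose P j (x : 'M[R[i]]_n * 'M[R[i]]_n) :=
  \sum_(j <= k < m.+1) bcoef R[i] k *: x.2 ^+ k.
(* Projections replace the destructuring of the pair, so that the rules of calculus apply term by
   term. *)
have -> : hmap S m = fun x => (x.1 *m P 0 x,
    x.2 - (x.1 *m P 0 x) ^t* *m S *m (x.1 *m P 1 x)
      - (x.1 *m P 1 x) ^t* *m S *m x.1).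
  by apply/funext => -[].
have dZ := bounded_frechet_fst (Z, 0 : 'M[R[i]]_n).
have dd := bounded_frechet_snd (Z, 0 : 'M[R[i]]_n).
have dS := bounded_frechet_cst S (Z, 0 : 'M[R[i]]_n).
have dA := bounded_frechetM dZ (@bounded_frechet_bsum _ _ Z m 0 m0 isT).
have dB := bounded_frechetM dZ (@bounded_frechet_bsum _ _ Z m 1 m0 isT).
have := bounded_frechet_pair dA (bounded_frechetD (bounded_frechetD dd
  (bounded_frechetN (bounded_frechetM (bounded_frechetM
    (bounded_frechet_trmxC dA) dS) dB)))
  (bounded_frechetN (bounded_frechetM (bounded_frechetM
    (bounded_frechet_trmxC dB) dS) dZ))).
(* At the base point the first sum is I and the second is 0. In the two products with [S], only the
   terms differentiating the second sum survive: Z^* S Z F / 2 and (Z F / 2)^* S Z. *)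
apply: bounded_frechet_eq => -[E F] /=; rewrite !bsum_expr0 /=.
rewrite !mulmx1 !mulmx0 trmxC0 !mul0mx !addr0 !add0r scalemxAr.
apply: f_equal2 => //; rewrite mulmxA Z_orth mul1mx.
rewrite trmxC_mul -!(mulmxA _ S) -mulmxA [Z ^t* *m _]mulmxA Z_orth mulmx1.
rewrite trmxC_half.
by apply/matrixP => i j; rewrite !mxE; field.
Qed.

Theorem mainTheorem5 (R : realType) (n m : nat) (S Z : 'M[R[i]]_n)
    (S_posdef : hermposdefmx S) (m_gt0 : (0 < m)%N)
    (Z_orth : Z ^t* *m S *m Z = 1%:M) :
  let L := frechet (hmap S m) (Z, 0) in
  [/\ frechet_differentiable (hmap S m) (Z, 0),
      forall E F : 'M[R[i]]_n,
        L (E, F) = (E + 2^-1 *: (Z *m F), 2^-1 *: (F - F ^t* )),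
      forall (p : nat) (E F : 'M[R[i]]_n), (0 < p)%N ->
        iter p L (E, F) =
          (E + 2^-1 *: (Z *m F) +
             (p%:R - 1) *: (4^-1 *: (Z *m (F - F ^t* ))),
           2^-1 *: (F - F ^t* )),
      forall E F : 'M[R[i]]_n, F \is hermsymmx ->
        iter 2 L (E, F) = L (E, F) &
      stable_at (hmap S m) (Z, 0)
        [set EF : 'M[R[i]]_n * 'M[R[i]]_n | EF.2 \is hermsymmx] ].
Proof.
move=> L; have [diffh LE] :=
  bounded_frechet_frechet (bounded_frechet_hmap m_gt0 Z_orth).
have iterL p (E F : 'M[R[i]]_n) : (0 < p)%N -> iter p L (E, F) =
    (E + 2^-1 *: (Z *m F) + (p%:R - 1) *: (4^-1 *: (Z *m (F - F ^t* ))),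
     2^-1 *: (F - F ^t* )).
  (* The induction starts at one application, where the coefficient [p%:R - 1] is 0. *)
  case: p => // p _; elim: p => [|p IHp].
    by rewrite /= /L LE /= subrr scale0r addr0.
  (* Here [G] lacks the factor 1/2: the second component is G / 2, so each further application adds
     Z G / 4. *)
  rewrite iterS IHp /L LE /=; set G := F - F ^t*.
  have GC : G ^t* = - G.
    by apply/matrixP => i j; rewrite !mxE rmorphB /= conjCK opprB.
  apply: f_equal2; last first.
    rewrite trmxC_half GC scalerN opprK -scalerDl; congr (_ *: _).
    by rewrite -[RHS]scale1r; congr (_ *: _); field.
  rewrite -scalemxAr; move: (Z *m F) (Z *m G) => U T.
  by apply/matrixP => i j; rewrite !mxE -!natr1; field.
have iter_herm q (E F : 'M[R[i]]_n) : F \is hermsymmx -> (0 < q)%N ->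
    iter q L (E, F) = (E + 2^-1 *: (Z *m F), 0).
  by move=> /hermsymmx_trmxC FC q0; rewrite iterL // FC subrr mulmx0 !scaler0 addr0.
split=> //.
- by move=> E F; rewrite /L LE.
- by move=> E F Fherm; rewrite iter_herm // -[L _]/(iter 1 L _) iter_herm.
split=> //.
- rewrite /hmap !bsum_expr0 /= mulmx0 mulmx1 trmxC0 !mulmx0 !mul0mx.
  by rewrite !subr0.
(* This bounds |E + Z F / 2| by the triangle inequality, as |E| and |F| are at most |(E, F)|. The
   iterates are constant, so it serves every [p]. *)
pose c := 1 + 2^-1 * (n%:R * `|Z|).
have c0 : 0 <= c by rewrite addr_ge0 ?mulr_ge0.
(* [c] is a nonnegative element of [R[i]], hence equal to its real part. *)
exists (complex.Re c) => -[E F] /= Fherm _ p p0.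
rewrite (RRe_real (ger0_real c0)) iter_herm //.
have [EEF FEF] : `|E| <= `|(E, F)| /\ `|F| <= `|(E, F)|.
  by rewrite prod_normE !comparable_le_max ?real_comparable // !lexx orbT.
rewrite [leLHS]prod_normE comparable_ge_max ?real_comparable //= normr0.
rewrite mulr_ge0 // andbT (le_trans (ler_normD _ _)) // /c mulrDl mul1r lerD //.
rewrite normrZ ger0_norm // -mulrA ler_wpM2l //.
by rewrite (le_trans (mx_norm_mulmx_le _ _)) // ler_wpM2l // mulr_ge0.
Qed.
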